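(* Let $\alpha,\beta,\gamma,\omega\in\mathbb{R}$ satisfy $\omega<0$, $0<\alpha\le 1$ and $0<\alpha\gamma\le\beta\le 1$. Define the stability region $$S_{\alpha,\beta,\omega}^{\gamma}=\{\lambda\in\mathbb{C} : s^{\beta-\alpha\gamma}(s^{\alpha}-\omega)^{\gamma}\neq\lambda \text{ for all } s\in\mathbb{C} \text{ with } \Re(s)\ge 0\}.$$ Let $\Psi=\{\Lambda(\theta) : \theta\in[0,\tfrac{\alpha\pi}{2})\}\subset\mathbb{C}$ be the curve parametrized by $$\Lambda(\theta)=|\omega|^{\frac{\beta}{\alpha}}\,\frac{(\sin\theta)^{\frac{\beta}{\alpha}-\gamma}\left(\sin\frac{\alpha\pi}{2}\right)^{\gamma}}{\left(\sin\left(\frac{\alpha\pi}{2}-\theta\right)\right)^{\frac{\beta}{\alpha}}}\;e^{i\left[\gamma\theta+(\beta-\alpha\gamma)\frac{\pi}{2}\right]},\qquad \theta\in\left[0,\tfrac{\alpha\pi}{2}\right),$$ and let $\overline{\Psi}=\{\lambda\in\mathbb{C} : \overline{\lambda}\in\Psi\}$ be its complex conjugate. Then $S_{\alpha,\beta,\omega}^{\gamma}$ is the region of the complex plane that includes $\mathbb{C}_-=\{\lambda\in\mathbb{C} : \Re(\lambda)<0\}$ and is bounded by $\Psi$ and $\overline{\Psi}$; that is, $S_{\alpha,\beta,\omega}^{\gamma}$ is the connected component of $\mathbb{C}\setminus(\Psi\cup\overline{\Psi})$ containing $\mathbb{C}_-$, and its boundary is $\Psi\cup\overline{\Psi}$.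
   Context: All complex powers are principal values: $z^p=e^{p\,\mathrm{Log}\,z}$ for $z\ne 0$, with $\mathrm{Arg}\, z\in(-\pi,\pi]$; moreover $0^p=0$ for $p>0$ and $0^0=1$ (used for $s=0$ and for $\sin\theta$ at $\theta=0$). The equation $s^{\beta-\alpha\gamma}(s^{\alpha}-\omega)^{\gamma}=\lambda$, with $\lambda$ an eigenvalue of $A$, is the characteristic equation of the linear system ${}_0^{C}\mathcal{D}^{\gamma}_{\alpha,\beta,\omega}y(t)=Ay(t)$ with the (Caputo-regularized) fractional Prabhakar derivative; the set $S_{\alpha,\beta,\omega}^{\gamma}$, defined purely in terms of this equation, is called the stability region of that system. *)

(* Defs.v *)
From HB Require Import structures.
From mathcomp Require Import all_boot all_order all_algebra.
From mathcomp Require Import all_classical all_reals all_analysis.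
From mathcomp Require Import complex.

Set Implicit Arguments.
Unset Strict Implicit.
Unset Printing Implicit Defensive.

Import Order.TTheory GRing.Theory Num.Theory.
Import numFieldNormedType.Exports.

Local Open Scope classical_set_scope.
Local Open Scope ring_scope.
Local Open Scope complex_scope.

(* [R[i]] carries the topology of its own norm; the library only equips the
   regular module [R[i]^o] with it. *)
HB.instance Definition _ (R : realType) := NormedModule.copy R[i] R[i]^o.

(* Principal argument, in ]-pi, pi]; the value at [z = 0] is irrelevant. *)
Definition Arg (R : realType) (z : R[i]) : R :=
  let t := acos (complex.Re z / complex.Re `|z|) in
  if 0 <= complex.Im z then t else - t.

Definition Cexp (R : realType) (z : R[i]) : R[i] :=
  (expR (complex.Re z))%:C * (cos (complex.Im z) +i* sin (complex.Im z)).

Definition Log (R : realType) (z : R[i]) : R[i] :=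
  ln (complex.Re `|z|) +i* Arg z.

(* As for [powR], [0 ^ p] is [1] if [p = 0] and [0] otherwise. *)
Definition cpow (R : realType) (z : R[i]) (p : R) : R[i] :=
  if z == 0 then (p == 0)%:R else Cexp (p%:C * Log z).

Lemma Re_norm_gt0 (R : realType) (z : R[i]) : z != 0 -> 0 < complex.Re `|z|.
Proof. by rewrite -normr_gt0 ltcE => /andP[]. Qed.

Lemma Arg_cos_itv (R : realType) (z : R[i]) : z != 0 ->
  -1 <= complex.Re z / complex.Re `|z| <= 1.
Proof.
move=> z0; have n0 := Re_norm_gt0 z0.
rewrite -ler_norml normrM normfV (gtr0_norm n0) ler_pdivrMr // mul1r.
by have := normc_ge_Re z; rewrite lecE => /andP[].
Qed.

Lemma Arg_itv (R : realType) (z : R[i]) : z != 0 -> - pi < Arg z <= pi.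
Proof.
move=> z0; have n0 := Re_norm_gt0 z0; have c1 := Arg_cos_itv z0.
rewrite /Arg; case: ifPn => [_|].
  by rewrite acos_lepi // andbT (lt_le_trans _ (acos_ge0 c1)) // oppr_lt0 pi_gt0.
rewrite -ltNge => zi0; apply/andP; split; last first.
  by rewrite (le_trans _ (pi_ge0 R)) // oppr_le0 acos_ge0.
rewrite ltrN2; apply: acos_ltpi; case/andP: c1 => c1 -> /=; rewrite andbT lt_neqAle c1 andbT.
apply/eqP => e; have : complex.Re `|z| ^+ 2 = complex.Re z ^+ 2.
  by rewrite -[complex.Re z](divfK (lt0r_neq0 n0)) -e mulN1r sqrrN.
rewrite normc_def /= sqr_sqrtr ?addr_ge0 ?sqr_ge0 // -[RHS]addr0 => /addrI/eqP.
by rewrite sqrf_eq0 lt_eqF.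
Qed.

Lemma Arg_polar (R : realType) (z : R[i]) : z != 0 ->
  z = `|z| * (cos (Arg z) +i* sin (Arg z)).
Proof.
move=> z0; have n0 := Re_norm_gt0 z0; have c1 := Arg_cos_itv z0.
have nE : `|z| = (complex.Re `|z|)%:C by rewrite normc_def.
have n2 : complex.Re `|z| ^+ 2 = complex.Re z ^+ 2 + complex.Im z ^+ 2.
  by rewrite normc_def /= sqr_sqrtr // addr_ge0 ?sqr_ge0.
have sE : sin (acos (complex.Re z / complex.Re `|z|)) =
    `|complex.Im z| / complex.Re `|z|.
  rewrite sin_acos // -[RHS]ger0_norm ?divr_ge0 // ?(ltW n0) // -sqrtr_sqr.
  congr Num.sqrt; rewrite !expr_div_n real_normK ?num_real //.
  have -> : complex.Im z ^+ 2 = complex.Re `|z| ^+ 2 - complex.Re z ^+ 2.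
    by rewrite n2 addrC addKr.
  by rewrite mulrBl divff // expf_neq0 // lt0r_neq0.
rewrite nE /Arg; apply/eqP; rewrite eq_complex /= !mul0r subr0 addr0.
case: ifPn => [zi|]; last rewrite -ltNge => zi.
  rewrite acosK ?in_itv //= sE ger0_norm //.
  by rewrite ![_ * (_ / _)]mulrC !divfK ?lt0r_neq0 // !eqxx.
rewrite cosN sinN acosK ?in_itv //= sE ltr0_norm //.
by rewrite mulNr opprK ![_ * (_ / _)]mulrC !divfK ?lt0r_neq0 // !eqxx.
Qed.

Lemma cpow_real (R : realType) (x p : R) : 0 <= x -> cpow x%:C p = (x `^ p)%:C.
Proof.
move=> x0; rewrite /cpow /powR eq_complex /= eqxx andbT.
case: ifPn => [_|xn0]; first by case: (p == 0).
have nE : complex.Re `|x%:C| = x.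
  by rewrite normc_def /= expr0n addr0 sqrtr_sqr ger0_norm.
rewrite /Cexp /Log /Arg nE /= lexx divff // acos1 !mul0r !mulr0 subr0 addr0.
rewrite cos0 sin0; apply/eqP; rewrite eq_complex /=.
by rewrite !mul0r !mulr0 mulr1 subr0 addr0 !eqxx.
Qed.

Definition boundary (T : topologicalType) (A : set T) : set T :=
  closure A `\` interior A.

Definition stability_region (R : realType) (alpha beta gamma omega : R) :
    set R[i] :=
  [set lambda | forall s : R[i], 0 <= complex.Re s ->
    cpow s (beta - alpha * gamma) *
    cpow (cpow s alpha - omega%:C) gamma != lambda].

Definition Lambda (R : realType) (alpha beta gamma omega theta : R) : R[i] :=
  (`|omega| `^ (beta / alpha) *
   (sin theta `^ (beta / alpha - gamma) * sin (alpha * pi / 2) `^ gamma /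
    sin (alpha * pi / 2 - theta) `^ (beta / alpha)))%:C *
  Cexp (0 +i* (gamma * theta + (beta - alpha * gamma) * (pi / 2))).

Definition Psi (R : realType) (alpha beta gamma omega : R) : set R[i] :=
  [set Lambda alpha beta gamma omega theta |
     theta in [set theta : R | 0 <= theta < alpha * pi / 2]].

Definition conj_set (R : realType) (A : set R[i]) : set R[i] :=
  [set lambda | A (conjc lambda)].

Definition Cminus (R : realType) : set R[i] := [set z | complex.Re z < 0].

(* Main.v *)
Require Import Defs.
From HB Require Import structures.
From mathcomp Require Import all_boot all_order all_algebra.
From mathcomp Require Import all_classical all_reals all_analysis.
From mathcomp Require Import complex ring lra.

(* Put u = s^alpha, a = alpha pi / 2, d = beta / alpha - gamma and w = - omega:
   the values to be avoided are u^d (u + w)^gamma for u in the closed sector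
   |arg u| <= a.  If u has argument eta >= 0 and u + w has argument theta, the
   value has argument d eta + gamma theta, and by the law of sines its modulus is
     w^(d+gamma) (sin theta / sin A)^d (sin (A + theta) / sin A)^gamma,
   where A = eta - theta.  On a fixed ray of the value plane, decreasing eta
   increases theta and decreases A, hence increases this modulus; so the values
   on that ray are exactly those of modulus at least the one reached at eta = a,
   that is, on the curve.  Along the curve the modulus increases with the
   argument, so the complement of the set of values is stable under rotation
   towards the negative real axis, which makes it connected. *)

Set Implicit Arguments.
Unset Strict Implicit.
Unset Printing Implicit Defensive.

Import Order.TTheory GRing.Theory Num.Theory.
Import numFieldNormedType.Exports.

Local Open Scope classical_set_scope.
Local Open Scope ring_scope.
Local Open Scope complex_scope.

(** * Polar coordinates, principal argument and principal powers *)

Section Polar.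
Context {R : realType}.
Implicit Types (m n t p : R) (z : R[i]).

Definition polar m t : R[i] := (m * cos t) +i* (m * sin t).
Definition modulus z : R := complex.Re `|z|.

Lemma modulusE z : `|z| = (modulus z)%:C.
Proof. by rewrite /modulus normc_def. Qed.

Lemma modulus_ge0 z : 0 <= modulus z.
Proof. by rewrite /modulus normc_def sqrtr_ge0. Qed.

Lemma modulus_gt0 z : (0 < modulus z) = (z != 0).
Proof.
by rewrite lt_def modulus_ge0 andbT -[z == 0]normr_eq0 modulusE eq_complex /= eqxx andbT.
Qed.

Lemma polarM m n t p : polar m t * polar n p = polar (m * n) (t + p).
Proof.
by apply/eqP; rewrite eq_complex /= cosD sinD; apply/andP; split; apply/eqP; ring.
Qed.

Lemma conjc_polar m t : conjc (polar m t) = polar m (- t).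
Proof. by rewrite /polar cosN sinN mulrN. Qed.

Lemma modulus_polar m t : 0 <= m -> modulus (polar m t) = m.
Proof.
move=> m0; rewrite /modulus normc_def /= !exprMn -mulrDr cos2Dsin2 mulr1.
by rewrite sqrtr_sqr ger0_norm.
Qed.

Lemma polar_eq0 m t : 0 <= m -> (polar m t == 0) = (m == 0).
Proof.
move=> m0; apply/negb_inj; rewrite -modulus_gt0 modulus_polar //.
by rewrite lt_def m0 andbT.
Qed.

Lemma polar0 t : polar 0 t = 0.
Proof. by rewrite /polar !mul0r. Qed.

Lemma polarE z : z = polar (modulus z) (Arg z).
Proof.
have [->|z0] := eqVneq z 0; first by rewrite /modulus normr0 polar0.
rewrite {1}[z]Arg_polar // modulusE; apply/eqP; rewrite eq_complex /=.
by rewrite !mul0r subr0 addr0 !eqxx.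
Qed.

Lemma sin_lt0_Npi t : - pi < t -> t < 0 -> sin t < 0.
Proof.
by move=> t1 t2; rewrite -oppr_gt0 -sinN sin_gt0_pi // oppr_gt0 t2 ltrNl.
Qed.

Lemma Arg_polarE m t : 0 < m -> - pi < t <= pi -> Arg (polar m t) = t.
Proof.
move=> m0 /andP[t1 t2]; rewrite /Arg -/(modulus _) modulus_polar ?(ltW m0)//=.
rewrite mulrAC divff ?gt_eqF// mul1r pmulr_rge0//.
have [t0|t0] := leP 0 t.
  by rewrite sin_ge0_pi ?t0// cosK// in_itv/= t0.
by rewrite leNgt sin_lt0_Npi//= cosKN ?opprK// (ltW t1) ltW.
Qed.

Lemma Re_ge0_Arg z : 0 <= complex.Re z -> z != 0 -> - (pi / 2) <= Arg z <= pi / 2.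
Proof.
move=> rz z0; have m0 : 0 < modulus z by rewrite modulus_gt0.
suff h : acos (complex.Re z / modulus z) <= pi / 2.
  rewrite /Arg -/(modulus z); have := acos_ge0 (Arg_cos_itv z0).
  by rewrite -/(modulus z); case: ifP => _; have := pi_ge0 R; lra.
have c1 := Arg_cos_itv z0.
rewrite leNgt; apply/negP => h.
have : cos (acos (complex.Re z / modulus z)) < cos (pi / 2).
  rewrite ltr_cos ?in_itv//= ?acos_ge0 ?acos_lepi//.
  by have := pi_ge0 R; lra.
by rewrite acosK// cos_pihalf ltNge divr_ge0// ltW.
Qed.

Lemma cpow_polar m t p : 0 <= m -> - pi < t <= pi ->
  cpow (polar m t) p = polar (m `^ p) (p * t).
Proof.
rewrite le_eqVlt => /predU1P[<- _|m0 tpi].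
  (* The conventions at the origin agree: for [p = 0] both powers are 1 and the angle [p * t]
     vanishes; otherwise both are 0. *)
  rewrite polar0 /cpow eqxx; have [->|p0] := eqVneq p 0.
    by rewrite powRr0 mul0r /polar cos0 sin0 mulr0 mulr1.
  by rewrite powR0// polar0.
rewrite /cpow polar_eq0 ?ltW// gt_eqF// /Cexp /Log -/(modulus _).
rewrite Arg_polarE// modulus_polar ?(ltW m0)// /powR gt_eqF//=.
apply/eqP; rewrite eq_complex /=.
by rewrite !mul0r !subr0 !addr0 !eqxx.
Qed.

End Polar.

(** * Continuity of truncated real functions *)

Section RealContinuity.
Context {R : realType}.
Implicit Types (a b p x y : R).

(** For [a <= b], composing with this retraction onto [a, b] turns continuity within the segment
    into continuity on the whole line, which composes freely with other maps. *)
Definition clamp a b x := Num.max a (Num.min b x).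

Lemma clamp_itv a b x : a <= b -> a <= clamp a b x <= b.
Proof. by move=> ab; rewrite /clamp le_max lexx ge_max ab ge_min lexx. Qed.

Lemma clamp_id a b x : a <= x <= b -> clamp a b x = x.
Proof. by move=> /andP[ax xb]; rewrite /clamp min_r// max_r. Qed.

Lemma clamp_homo a b : {homo clamp a b : x y / x <= y}.
Proof.
by move=> x y xy; rewrite /clamp ge_max le_max lexx/= le_max le_min !ge_min lexx xy !orbT.
Qed.

Lemma continuous_clamp a b : continuous (clamp a b).
Proof.
move=> x; apply: (@continuous_max _ _ (cst a) (fun y => Num.min b y)).
  exact: cvg_cst.
by apply: (@continuous_min _ _ (cst b) id); [exact: cvg_cst|exact: cvg_id].
Qed.

Lemma continuous_comp_clamp (f : R -> R) a b : a <= b ->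
  {within `[a, b], continuous f} -> continuous (f \o clamp a b).
Proof.
move=> ab /subspace_continuousP fab x.
have cab : `[a, b]%classic (clamp a b x) by rewrite /= in_itv/= clamp_itv.
apply: cvg_comp (fab _ cab) => A /= fA.
have fA' : nbhs x (fun y => clamp a b y \in `[a, b] -> A (clamp a b y)).
  exact: (@continuous_clamp a b x _ fA).
by apply: filterS fA' => y; apply; rewrite in_itv/= clamp_itv.
Qed.

Lemma continuous_acos_clamp : continuous (@acos R \o clamp (-1) 1).
Proof.
apply: continuous_comp_clamp; first lra.
(* A strictly decreasing surjection between segments is continuous, endpoints -1 and 1 included. *)
apply: segment_dec_surj_continuous => [|].
  apply: le_nmono_in => x y; rewrite !in_itv/= => x1 y1 xy.
  rewrite -ltr_cos ?in_itv/= ?acos_ge0 ?acos_lepi//.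
  by rewrite !acosK.
move=> t; rewrite acos1 acosN1 /= in_itv/= => t0; exists (cos t).
  by rewrite /= in_itv/= cos_geN1 cos_le1.
by rewrite cosK.
Qed.

(* [x `^ p] is [1] for [x < 0]; truncating [x] makes the power continuous at [0]. *)
Definition powR_pos p x := Num.max 0 x `^ p.

Lemma powR_posE p x : 0 <= x -> powR_pos p x = x `^ p.
Proof. by move=> x0; rewrite /powR_pos max_r. Qed.

(** For [p > 0] the power is strictly increasing on [0, M] and is inverted by the exponent 1/p,
    hence continuous there; since [M] exceeds [x], the upper truncation is inactive near [x]. *)
Lemma continuous_powR_pos p : 0 <= p -> continuous (powR_pos p).
Proof.
rewrite le_eqVlt => /predU1P[<-|p0].
  rewrite (_ : powR_pos 0 = cst 1); first by move=> x; exact: cvg_cst.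
  by apply/funext => x; rewrite /powR_pos powRr0.
move=> x; pose M := `|x| + 1.
have M0 : 0 <= M by rewrite addr_ge0.
have xM : x < M by rewrite /M; have := ler_norm x; lra.
have c : continuous ((fun y => y `^ p) \o clamp 0 M).
  apply: continuous_comp_clamp => //; apply: segment_inc_surj_continuous.
    apply: le_mono_in => y z; rewrite !in_itv/= => /andP[y0 _] /andP[z0 _].
    exact: gt0_ltr_powR.
  move=> y /=; rewrite powR0 ?gt_eqF// !in_itv/= => /andP[y0 yM].
  exists (y `^ p^-1); last by rewrite -powRrM mulVf ?gt_eqF// powRr1.
  rewrite /= in_itv/= powR_ge0/= -[leRHS]powRr1// -(mulfV (lt0r_neq0 p0)) powRrM.
  by apply: ge0_ler_powR; rewrite ?nnegrE ?powR_ge0// invr_ge0 ltW.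
have cx : (clamp 0 M y) `^ p @[y --> x] --> powR_pos p x.
  by rewrite /powR_pos -[x in Num.max 0 x](@min_r _ _ M x) ?ltW//; exact: c.
apply: cvg_trans cx; apply: near_eq_cvg; near=> y.
rewrite /powR_pos /clamp (@min_r _ _ M y)//.
by apply: ltW; near: y; exact: lt_nbhsl.
Unshelve. all: by end_near. Qed.

End RealContinuity.

(** * Components and boundary when a complement splits into two open sets *)

Lemma component_boundary_of_split (T : topologicalType) (S U C : set T) :
  open S -> open U -> S `&` U = set0 -> ~` C = S `|` U -> connected S ->
  C `<=` closure S ->
  (forall z, S z -> connected_component (~` C) z = S) /\ boundary S = C.
Proof.
move=> oS oU SU0 CE cS CS; split=> [z Sz|].
  apply/seteqP; split => y; last first.
    by apply: connected_component_max => //; rewrite CE; exact: subsetUl.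
  move=> [B [Bz BC cB] By].
  suff BS : B `&` S = B by move: By; rewrite -BS => -[].
  apply: cB; [by exists z|by exists S|].
  (* Relative to [B], the set [S] is also closed, because what it misses there is cut out by the
     open set [U]. *)
  exists (~` U); first exact: open_closedC.
  apply/seteqP; split => x [Bx xP]; split => //.
    by move=> Ux; have : (S `&` U) x by []; rewrite SU0.
  by have := BC _ Bx; rewrite CE => -[].
have iS : interior S = S.
  by apply/seteqP; split; [exact: interior_subset|move: oS; rewrite openE].
rewrite /boundary iS.
apply/seteqP; split => y.
  (* A boundary point off [C] would lie in [U], an open set without points of [S]. *)
  move=> [clS nS]; apply: contrapT => nC.
  have : (~` C) y by [].
  rewrite CE => -[//|Uy].
  have [v [Sv Uv]] := clS _ (open_nbhs_nbhs (conj oU Uy)).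
  by have : (S `&` U) v by []; rewrite SU0.
move=> Cy; split; first exact: CS.
by move=> Sy; have : (~` C) y by rewrite CE; left.
Qed.

(** * Continuity of the modulus and of the unsigned argument *)

Section ComplexContinuity.
Context {R : realType}.
Implicit Types (z : R[i]).

Lemma modulus_sqrt z :
  modulus z = Num.sqrt (complex.Re z ^+ 2 + complex.Im z ^+ 2).
Proof. by rewrite /modulus normc_def. Qed.

Lemma Re_le_modulus z : `|complex.Re z| <= modulus z.
Proof. by rewrite modulus_sqrt -sqrtr_sqr ler_wsqrtr// lerDl sqr_ge0. Qed.

Lemma modulus_le z : modulus z <= `|complex.Re z| + `|complex.Im z|.
Proof.
rewrite modulus_sqrt -[leRHS]ger0_norm ?addr_ge0// -sqrtr_sqr ler_wsqrtr//.
rewrite sqrrD !real_normK ?num_real// lerD2r lerDl.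
by rewrite mulrn_wge0// mulr_ge0.
Qed.

Lemma modulus_lipschitz_continuous (f : R[i] -> R) :
  (forall z v, `|f z - f v| <= modulus (z - v)) -> continuous f.
Proof.
move=> fL z.
apply/(@cvgrPdist_lt _ R^o _ (nbhs z) (nbhs_filter z)) => e e0.
have e0' : 0 < e%:C by rewrite ltcR.
have := @cvgr_dist_lt _ R[i] _ (nbhs z) (nbhs_filter z) id z (@cvg_id _ (nbhs z)) _ e0'.
apply: filterS => v.
by rewrite modulusE ltcR; apply: le_lt_trans.
Qed.

Lemma continuous_Re : continuous (@complex.Re R : R[i] -> R).
Proof.
apply: modulus_lipschitz_continuous => z v; have := Re_le_modulus (z - v).
by case: z v => [x y] [x' y'].
Qed.

Lemma continuous_modulus : continuous (@modulus R : R[i] -> R).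
Proof.
apply: modulus_lipschitz_continuous => z v.
have := ler_dist_dist z v; rewrite !modulusE lecR -rmorphB/=.
by rewrite [leLHS]modulus_sqrt /= expr0n addr0 sqrtr_sqr.
Qed.

Lemma continuous_complex (T : topologicalType) (f : T -> R[i]) :
  continuous (@complex.Re R \o f) -> continuous (@complex.Im R \o f) ->
  continuous f.
Proof.
move=> cr ci x; apply/cvgrPdist_lt => e.
(* The norm of [R[i]] takes its values in [R[i]]; positivity of [e] forces its imaginary part to be
   0. *)
rewrite ltcE /= => /andP[/eqP ei er].
have er2 : 0 < complex.Re e / 2 by rewrite divr_gt0.
have h1 := @cvgr_dist_lt _ R^o _ (nbhs x) (nbhs_filter x) _ _ (cr x) _ er2.
have h2 := @cvgr_dist_lt _ R^o _ (nbhs x) (nbhs_filter x) _ _ (ci x) _ er2.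
apply: filterS2 h1 h2 => y h1 h2.
rewrite modulusE; case: e ei er er2 h1 h2 => e e' /= -> er er2 h1 h2.
rewrite -[_ +i* _]/(e%:C) ltcR (le_lt_trans (modulus_le _))// [ltRHS]splitr.
by move: h1 h2; case: (f x) (f y) => [u v] [u' v'] /= h1 h2; exact: ltrD.
Qed.

Lemma continuous_polar m : continuous (polar m : R -> R[i]).
Proof.
apply: continuous_complex => t; apply: cvgMl_tmp.
  exact: continuous_cos.
exact: continuous_sin.
Qed.

Lemma continuous_polar_modulus t : continuous (polar^~ t : R -> R[i]).
Proof.
by apply: continuous_complex => m; apply: cvgMr_tmp; exact: cvg_id.
Qed.

(** The absolute value of the argument: unlike [Arg], it is continuous across the negative real axis
    and blind to conjugation. *)
Definition aarg z : R := acos (complex.Re z / modulus z).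

Lemma aarg_itv z : z != 0 -> 0 <= aarg z <= pi.
Proof.
by move=> /Arg_cos_itv c1; rewrite acos_ge0// acos_lepi.
Qed.

Lemma aarg_conj z : aarg (conjc z) = aarg z.
Proof. by case: z => x y; rewrite /aarg !modulus_sqrt /= sqrrN. Qed.

Lemma modulus_conj z : modulus (conjc z) = modulus z.
Proof. by case: z => x y; rewrite !modulus_sqrt /= sqrrN. Qed.

Lemma aarg_polar_cos m t : 0 < m -> aarg (polar m t) = acos (cos t).
Proof.
move=> m0; rewrite /aarg modulus_polar ?ltW//=.
by rewrite mulrAC divff ?gt_eqF// mul1r.
Qed.

Lemma aarg_polar m t : 0 < m -> 0 <= t <= pi -> aarg (polar m t) = t.
Proof.
by move=> m0 t0; rewrite aarg_polar_cos// cosK// in_itv.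
Qed.

Lemma polar_aarg z :
  z = polar (modulus z) (aarg z) \/ z = conjc (polar (modulus z) (aarg z)).
Proof.
rewrite conjc_polar; have := polarE z; rewrite /Arg -/(modulus z) -/(aarg z).
by case: ifP => _; [left|right].
Qed.

Lemma continuous_aarg z : z != 0 -> {for z, continuous (aarg : R[i] -> R)}.
Proof.
move=> z0; pose f (v : R[i]) : R := complex.Re v / modulus v.
have cz : {for z, continuous (f : R[i] -> R)}.
  apply: (@continuousM _ _ (@complex.Re R) (fun v : R[i] => (modulus v)^-1)).
    exact: continuous_Re.
  apply: (@continuousV _ _ (@modulus R)); last exact: continuous_modulus.
  by rewrite gt_eqF// modulus_gt0.
(* The quotient always lies in [-1, 1] (it is 0 at the origin), so the clamp changes no value. *)
rewrite (_ : aarg = (@acos R \o clamp (-1) 1) \o f).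
  by apply: continuous_comp => //; exact: continuous_acos_clamp.
apply/funext => v; rewrite /aarg /= clamp_id// /f.
have [->|v0] := eqVneq v 0; last exact: Arg_cos_itv.
by rewrite mul0r; lra.
Qed.

End ComplexContinuity.

(** * Monotonicity of the sine, products of powers, law of sines *)

Lemma ler_sin_pihalf {R : realType} (x y : R) :
  0 <= x -> x <= y -> y <= pi / 2 -> sin x <= sin y.
Proof.
move=> x0 xy y2; have [->//|xy'] := eqVneq x y.
by apply: ltW; rewrite ltr_sin ?in_itv/= ?lt_neqAle ?xy' ?xy//; lra.
Qed.

Lemma powR_prodD {R : realType} (c x y p q : R) : 0 <= c -> 0 <= x -> 0 <= y ->
  p + q != 0 -> (x * c) `^ p * (y * c) `^ q = x `^ p * y `^ q * c `^ (p + q).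
Proof.
by move=> c0 x0 y0 pq; rewrite !powRM// powRD ?(negPf pq)// mulrACA.
Qed.

(** With u = [polar t eta], the triangle with vertices 0, w and u + w has angle [theta] at 0 and
    [eta - theta] at u + w. The last two equations are its law of sines, cleared of denominators so
    as to survive degenerate triangles. *)
Lemma triangle {R : realType} (w t eta : R) : 0 < w -> 0 <= t -> 0 <= eta <= pi / 2 ->
  exists p theta, [/\ w <= p, 0 <= theta <= eta,
    polar t eta + w%:C = polar p theta,
    t * sin (eta - theta) = w * sin theta &
    p * sin (eta - theta) = w * sin eta].
Proof.
have pi0 := pi_gt0 R.
move=> w0 t0 /andP[e0 e2]; set z := polar t eta + w%:C.
have se0 : 0 <= sin eta by rewrite sin_ge0_pi// e0; lra.
have ce0 : 0 <= cos eta by rewrite cos_ge0_pihalf//; lra.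
have rz : w <= complex.Re z by rewrite /= lerDr mulr_ge0.
have z0 : z != 0.
  by apply/eqP => zE; move: rz; rewrite zE /= leNgt w0.
have /andP[T1 T2] := Re_ge0_Arg (le_trans (ltW w0) rz) z0.
have m0 : 0 < modulus z by rewrite modulus_gt0.
have := polarE z; move: (Arg z) (modulus z) m0 T1 T2 => theta p p0 T1 T2 zE.
have reE : t * cos eta + w = p * cos theta by have := congr1 (@complex.Re R) zE.
have imE : t * sin eta = p * sin theta.
  by have := congr1 (@complex.Im R) zE; rewrite /= addr0.
have wp : w <= p.
  rewrite (le_trans rz)// zE /=.
  by rewrite ger_pMr// cos_le1.
have st0 : 0 <= sin theta by rewrite -(pmulr_rge0 _ p0) -imE mulr_ge0.
have pE : p * sin (eta - theta) = w * sin eta.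
  transitivity (sin eta * (p * cos theta) - cos eta * (p * sin theta)).
    by rewrite sinB; ring.
  by rewrite -reE -imE; ring.
have tE : t * sin (eta - theta) = w * sin theta.
  apply: (mulfI (lt0r_neq0 p0)).
  transitivity (t * (p * sin (eta - theta))); first by ring.
  by rewrite pE; transitivity (w * (t * sin eta)); [ring|rewrite imE; ring].
(* The bounds on [theta] come from signs: [theta] and [eta - theta] both exceed -pi and have
   nonnegative sines. *)
exists p, theta; split => //; apply/andP; split.
  by rewrite leNgt; apply/negP => T0; have := @sin_lt0_Npi _ theta; lra.
have : 0 <= sin (eta - theta) by rewrite -(pmulr_rge0 _ p0) pE mulr_ge0// ltW.
rewrite -subr_ge0 => s0; rewrite leNgt; apply/negP => T0.
by have := @sin_lt0_Npi _ (eta - theta); lra.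
Qed.

(** * The values u^d (u + w)^g over a sector, in polar coordinates *)

Section Sector.
Context {R : realType} (a d g w : R).
(* alpha, beta, gamma, |omega| enter as a = alpha pi / 2, d = beta / alpha - gamma,
   g = gamma, w = |omega|, so that beta / alpha = d + g. *)
Context (a_gt0 : 0 < a) (a_le : a <= pi / 2) (d_ge0 : 0 <= d) (g_gt0 : 0 < g).
Context (w_gt0 : 0 < w) (ba_le : (d + g) * a <= pi / 2).

Let b_gt0 : 0 < d + g. Proof. exact: ltr_wpDl. Qed.

Let sa_gt0 : 0 < sin a.
Proof. by rewrite sin_gt0_pi// a_gt0/=; have := pi_gt0 R; have := a_le; lra. Qed.

(* [lra] does not look at section hypotheses. *)
Ltac params := have a0 := a_gt0; have a2 := a_le; have d0 := d_ge0;
  have g0 := g_gt0; have w0 := w_gt0; have ba := ba_le; have b0 := b_gt0;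
  have sa0 := sa_gt0; have pi0 := pi_gt0 R.

Definition sector_map t eta : R[i] :=
  polar (t `^ d) (d * eta) * cpow (polar t eta + w%:C) g.

Lemma sector_map_polar t eta p theta : 0 <= p -> - pi < theta <= pi ->
  polar t eta + w%:C = polar p theta ->
  sector_map t eta = polar (t `^ d * p `^ g) (d * eta + g * theta).
Proof. by move=> p0 tpi e; rewrite /sector_map e cpow_polar// polarM. Qed.

(* [level m phi >= 0] says that, along the ray of argument [phi], the modulus
   [m] is at least that of the point of the curve; multiplying by
   [sin (a - theta) `^ (d + g)] keeps it continuous up to the asymptote. *)
Definition theta_of phi := clamp 0 a ((phi - d * a) / g).

Definition level m phi := m * sin (a - theta_of phi) `^ (d + g) -
  w `^ (d + g) * (sin (theta_of phi) `^ d * sin a `^ g).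

Lemma theta_of_itv phi : 0 <= theta_of phi <= a.
Proof. by rewrite clamp_itv// ltW. Qed.

Lemma level_powE theta : 0 <= theta <= a ->
  w `^ (d + g) * (sin theta `^ d * sin a `^ g) =
  (w * sin theta) `^ d * (w * sin a) `^ g.
Proof.
params; move=> /andP[h0 ha]; rewrite -[w * sin theta]mulrC -[w * sin a]mulrC.
have sT : 0 <= sin theta by apply: sin_ge0_pi; lra.
by rewrite powR_prodD ?(ltW w0) ?(ltW sa0) ?gt_eqF// mulrC.
Qed.

(** As [phi] grows, so does [theta_of phi] within [0, a]; then sin theta increases and sin (a -
    theta) decreases, which lowers the first term and raises the subtracted one. *)
Lemma level_homo m phi psi : 0 <= m -> phi <= psi -> level m psi <= level m phi.
Proof.
params; move=> m0 pp.
have h : theta_of phi <= theta_of psi.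
  by apply: clamp_homo; rewrite ler_pM2r ?invr_gt0// lerB.
have /andP[A1 A2] := theta_of_itv phi; have /andP[B1 B2] := theta_of_itv psi.
apply: lerB; rewrite ler_wpM2l ?powR_ge0//.
  by rewrite ge0_ler_powR ?nnegrE ?(ltW b0)//;
    [apply: sin_ge0_pi|apply: sin_ge0_pi|apply: ler_sin_pihalf]; lra.
rewrite ler_wpM2r ?powR_ge0//.
by rewrite ge0_ler_powR ?nnegrE//;
  [apply: sin_ge0_pi|apply: sin_ge0_pi|apply: ler_sin_pihalf]; lra.
Qed.

Lemma level_theta_max m phi : theta_of phi = a -> level m phi < 0.
Proof.
params; move=> tE; rewrite /level tE subrr sin0 powR0 ?gt_eqF// mulr0 sub0r.
by rewrite oppr_lt0 !mulr_gt0// powR_gt0.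
Qed.

(** The bound [(d + g) * a] is the argument of the curve in the limit theta -> a, where its modulus
    blows up; in that direction and beyond, no modulus is large enough. *)
Lemma level_max m phi : (d + g) * a <= phi -> level m phi < 0.
Proof.
params; move=> h; apply: level_theta_max.
rewrite /theta_of /clamp min_l; last by rewrite ler_pdivlMr//; lra.
by rewrite max_r// ltW.
Qed.

(** The value is compared factor by factor with the curve point on the same ray. The last clause
    records that only the factor t^d can vanish, which 0^0 = 1 prevents when [d = 0]. *)
Lemma level_sector t eta : 0 <= t -> 0 <= eta <= a -> exists m phi,
  [/\ 0 <= m, 0 <= phi < (d + g) * a, sector_map t eta = polar m phi,
    0 <= level m phi & (m == 0) = (t == 0) && (d != 0)].
Proof.
params; move=> t0 /andP[e0 ea].
have [|p [theta [wp /andP[T0 Te] zE tE pE]]] := @triangle _ w t eta w0 t0.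
  by rewrite e0/=; lra.
exists (t `^ d * p `^ g), (d * eta + g * theta).
have p0 : 0 < p by lra.
(* If [theta] reached [a], then [eta = theta], and the law of sines would give w sin a = 0. *)
have Ta : theta < a.
  rewrite lt_neqAle (le_trans Te ea) andbT; apply/eqP => Ta.
  have ee : eta = theta by lra.
  move: pE; rewrite ee subrr sin0 mulr0 Ta => /esym/eqP.
  by rewrite mulf_eq0 !gt_eqF.
have de0 : 0 <= d * (a - eta) by rewrite mulr_ge0//; lra.
have gT0 : g * theta < g * a by rewrite ltr_pM2l.
have gT1 : 0 <= g * theta by rewrite mulr_ge0// ltW.
split.
- by rewrite mulr_ge0// powR_ge0.
- by have : 0 <= d * eta by [rewrite mulr_ge0]; lra.
- by apply: sector_map_polar => //; lra.
- rewrite /level subr_ge0.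
  have /andP[A1 A2] := theta_of_itv (d * eta + g * theta).
  rewrite level_powE ?A1//.
  set th := theta_of _ in A1 A2 *.
  have sA0 : 0 <= sin (a - th) by apply: sin_ge0_pi; lra.
  have sT0 : 0 <= sin th by apply: sin_ge0_pi; lra.
  rewrite -powR_prodD ?(ltW p0) ?gt_eqF//.
  (* The exponent d + g is now distributed over the two factors, so comparing the bases is
     enough. *)
  suff [h1 h2] : w * sin th <= t * sin (a - th) /\
                 w * sin a <= p * sin (a - th).
    by apply: ler_pM; rewrite ?powR_ge0// ge0_ler_powR// ?nnegrE ?(ltW g0)
      ?mulr_ge0// ltW.
  (* This solves d a + g u = d eta + g theta: it is the curve parameter of the same argument, before
     truncation at 0. *)
  set u := (d * eta + g * theta - d * a) / g.
  have uT : u <= theta by rewrite /u ler_pdivrMr//; lra.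
  have [u0|u0] := leP u 0.
    have -> : th = 0 by rewrite /th /theta_of -/u /clamp min_r ?max_l//; lra.
    rewrite sin0 mulr0 subr0; split; first by rewrite mulr_ge0// ltW.
    by rewrite ler_pM2r.
  have thE : th = u by rewrite /th /theta_of clamp_id// -/u; lra.
  rewrite thE in A1 A2 sA0 sT0 *.
  set A := eta - theta in tE pE.
  have A0 : 0 < A.
    rewrite lt_neqAle subr_ge0 Te andbT; apply/eqP => A0.
    move: tE; rewrite -A0 sin0 mulr0 => /esym/eqP.
    rewrite mulf_eq0 gt_eqF//= gt_eqF// sin_gt0_pi//; lra.
  have sA1 : 0 < sin A by rewrite sin_gt0_pi// A0/= /A; lra.
  have AA : A <= a - u by rewrite /A; lra.
  split.
    rewrite (@le_trans _ _ (t * sin A))//.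
      rewrite tE; apply: ler_wpM2l; [exact: ltW|apply: ler_sin_pihalf; lra].
    by apply: ler_wpM2l => //; apply: ler_sin_pihalf; lra.
  (* Multiplying by [sin A] and using p sin A = w sin eta, the claim becomes sin a sin A <= sin eta
     sin (a - u). Once sin eta is bounded below by sin (A + u), the gap is exactly sin u sin (a - u
     - A). *)
  rewrite -(ler_pM2r sA1) [leRHS]mulrAC pE -!mulrA.
  rewrite ler_wpM2l ?(ltW w0)//.
  have h1 : sin (A + u) <= sin eta by apply: ler_sin_pihalf; rewrite /A; lra.
  apply: (@le_trans _ _ (sin (A + u) * sin (a - u))); last by rewrite ler_wpM2r.
  have h2 : 0 <= sin u * sin (a - u - A).
    by rewrite mulr_ge0// sin_ge0_pi//; lra.
  have -> : sin a = sin ((a - u) + u) by rewrite subrK.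
  move: h2; rewrite (sinB (a - u)) !(sinD _ u).
  set x := sin (a - u); set y := cos (a - u); nra.
- by rewrite mulf_eq0 !powR_eq0 (gt_eqF p0) /= orbF.
Qed.

(** On the positive axis the triangle is flat and the law of sines gives no information; the
    intermediate value theorem is applied to t^d (t + w)^g directly. *)
Lemma sector_map_surj0 m : 0 < m -> 0 <= level m 0 ->
  exists t eta, [/\ 0 <= t, 0 <= eta <= a & sector_map t eta = polar m 0].
Proof.
params; move=> m0 l0; pose f t := powR_pos d t * powR_pos g (t + w).
have cf : continuous f.
  move=> t; apply: cvgM; first exact: continuous_powR_pos.
  apply: (@continuous_comp _ _ _ (fun t => t + w) (powR_pos g)).
    by apply: cvgD; [exact: cvg_id|exact: cvg_cst].
  by apply: continuous_powR_pos; exact: ltW.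
have f0 : f 0 <= m.
  rewrite /f add0r !powR_posE ?(ltW w0)//.
  (* At t = 0 the value is 0 unless [d = 0]; in that case it is w^g, and [l0] says precisely that
     [m] is at least w^g. *)
  have [dE|dn0] := eqVneq d 0; last by rewrite powR0// mul0r ltW.
  move: l0; rewrite /level /theta_of dE mul0r subr0 mul0r clamp_id ?lexx ?(ltW a0)//.
  rewrite subr0 !powRr0 !mul1r add0r subr_ge0 ler_pM2r// powR_gt0//.
(* Chosen so that T^d T^g = m, which is at most T^d (T + w)^g. *)
pose T := m `^ (d + g)^-1.
have T0 : 0 <= T by exact: powR_ge0.
have fT : m <= f T.
  rewrite /f !powR_posE ?addr_ge0 ?(ltW w0)//.
  have -> : m = T `^ d * T `^ g.
    rewrite -powRD; last by rewrite gt_eqF.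
    by rewrite /T -powRrM mulVf ?gt_eqF// powRr1// ltW.
  rewrite ler_wpM2l ?powR_ge0// ge0_ler_powR ?nnegrE ?addr_ge0 ?(ltW w0) ?(ltW g0)//.
  by rewrite lerDl ltW.
have [||t tT ft] := @IVT _ f 0 T m T0.
- exact: continuous_subspaceT.
- by rewrite ge_min f0 le_max fT orbT.
move: tT; rewrite in_itv/= => /andP[t0 _].
exists t, 0; split => //; first by rewrite lexx ltW.
have tw0 : 0 <= t + w by lra.
rewrite (@sector_map_polar t 0 (t + w) 0 tw0); last 2 first.
- by lra.
- by apply/eqP; rewrite eq_complex /= cos0 sin0 !mulr0 !mulr1 addr0 !eqxx.
by rewrite -ft /f !powR_posE// !mulr0 addr0.
Qed.

(** A fixed argument [phi] ties theta to [eta] by d eta + g theta = phi, leaving one unknown.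
    [D eta] is [m] minus the modulus of the value, times sin (eta - theta)^(d + g); a zero of [D] is
    sought. *)
Lemma sector_map_surj m phi : 0 < m -> 0 <= phi -> 0 <= level m phi ->
  exists t eta, [/\ 0 <= t, 0 <= eta <= a & sector_map t eta = polar m phi].
Proof.
params; move=> m0; rewrite le_eqVlt => /predU1P[<-|p0] lp.
  exact: sector_map_surj0.
have pb : phi < (d + g) * a.
  by rewrite ltNge; apply/negP => /(@level_max m); lra.
pose th eta := (phi - d * eta) / g.
pose N eta := w `^ (d + g) * (powR_pos d (sin (th eta)) * powR_pos g (sin eta)).
pose D eta := m * powR_pos (d + g) (sin (eta - th eta)) - N eta.
have cth : continuous th.
  move=> t; apply: cvgMr_tmp; apply: cvgB; first exact: cvg_cst.
  by apply: cvgMl_tmp; exact: cvg_id.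
have cD : continuous D.
  move=> t; apply: cvgB; apply: cvgMl_tmp.
    apply: (@continuous_comp _ _ _ (fun t => sin (t - th t)) (powR_pos (d + g))).
      apply: (@continuous_comp _ _ _ (fun t => t - th t) sin).
        by apply: cvgB; [exact: cvg_id|exact: cth].
      exact: continuous_sin.
    by apply: continuous_powR_pos; exact: ltW.
  apply: cvgM.
    apply: (@continuous_comp _ _ _ (sin \o th) (powR_pos d)); last exact: continuous_powR_pos.
    by apply: continuous_comp; [exact: cth|exact: continuous_sin].
  apply: continuous_comp; first exact: continuous_sin.
  by apply: continuous_powR_pos; exact: ltW.
(* Here theta = eta: the modulus of the value is infinite in the limit, and [D] is negative. *)
pose e0 := phi / (d + g).
have e0_gt0 : 0 < e0 by rewrite divr_gt0.
have e0a : e0 < a by rewrite ltr_pdivrMr// mulrC.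
have the0 : th e0 = e0.
  by rewrite /th /e0; field; rewrite !gt_eqF.
(* The other end is the smaller of [a], where the sign of [D] is the hypothesis on [level], and phi
   / d, where theta = 0 kills the subtracted term. *)
have [e1 [e01 e1a pde1 De1]] : exists e1,
    [/\ e0 <= e1, e1 <= a, d * e1 <= phi & 0 <= D e1].
  have [h|h] := leP (d * a) phi.
    exists a; split => //; first exact: ltW.
    move: lp; rewrite /level /D /N /theta_of clamp_id; last first.
      rewrite divr_ge0 ?subr_ge0 ?(ltW g0)//= ler_pdivrMr//; lra.
    have h1 : 0 <= th a by rewrite divr_ge0 ?subr_ge0// ltW.
    have h2 : th a <= a by rewrite ler_pdivrMr//; lra.
    by rewrite !powR_posE//; [lra|apply: sin_ge0_pi..]; lra.
  have dp : 0 < d.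
    rewrite lt_neqAle d0 andbT; apply/eqP => dE.
    by move: h; rewrite -dE mul0r; lra.
  exists (phi / d); split.
  - by rewrite ler_pM2l// lef_pV2 ?posrE//; lra.
  - by rewrite ler_pdivrMr//; lra.
  - by rewrite mulrC divfK ?gt_eqF.
  - rewrite /D /N /th (mulrC d) divfK ?gt_eqF// subrr mul0r sin0.
    rewrite [powR_pos d 0]powR_posE// powR0 ?gt_eqF//.
    by rewrite mul0r mulr0 subr0 mulr_ge0 ?(ltW m0)// powR_ge0.
have thI eta : e0 <= eta -> d * eta <= phi -> 0 <= th eta <= eta.
  rewrite /e0 ler_pdivrMr// => h1 h2.
  by rewrite divr_ge0 ?subr_ge0 ?(ltW g0)//= ler_pdivrMr//; lra.
have De0 : D e0 < 0.
  rewrite /D /N the0 subrr sin0 [powR_pos (d + g) 0]powR_posE// powR0 ?gt_eqF// mulr0 sub0r.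
  have s0 : 0 < sin e0 by rewrite sin_gt0_pi// e0_gt0/=; lra.
  by rewrite oppr_lt0 !powR_posE ?(ltW s0)// !mulr_gt0// powR_gt0.
have [||eta] := @IVT _ D e0 e1 0 e01.
- exact: continuous_subspaceT.
- by rewrite ge_min (ltW De0) le_max De1 orbT.
rewrite in_itv/= => /andP[e0e ee1] De.
have de : d * eta <= phi by rewrite (le_trans _ pde1)// ler_wpM2l.
have /andP[T0 Te] := thI _ e0e de.
have sT0 : 0 <= sin (th eta) by apply: sin_ge0_pi; lra.
have se0 : 0 < sin eta by apply: sin_gt0_pi; lra.
have A0 : 0 < eta - th eta.
  rewrite lt_neqAle subr_ge0 Te andbT eq_sym subr_eq0; apply/eqP => eT.
  move/eqP: De; rewrite /D -eT subrr sin0 [powR_pos (d + g) 0]powR_posE// powR0 ?(gt_eqF b0)//.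
  rewrite mulr0 sub0r oppr_eq0 /N -eT !powR_posE ?(ltW se0)//.
  by rewrite gt_eqF// !mulr_gt0// powR_gt0.
have sA0 : 0 < sin (eta - th eta) by apply: sin_gt0_pi; lra.
set s := sin (eta - th eta) in sA0.
(* The law of sines dictates this modulus of u, and [w * sin eta / s] for the modulus of u + w. *)
exists (w * sin (th eta) / s), eta; split.
- by rewrite divr_ge0 ?mulr_ge0// ltW.
- by lra.
rewrite (@sector_map_polar _ _ (w * sin eta / s) (th eta)).
- congr polar; last by rewrite /th; field; rewrite gt_eqF.
  apply: (mulIf (lt0r_neq0 (powR_gt0 (d + g) sA0))).
  have -> : m * s `^ (d + g) = N eta.
    by move: De; rewrite /D powR_posE ?(ltW sA0)// => /eqP; rewrite subr_eq0 => /eqP.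
  rewrite -powR_prodD ?divr_ge0 ?mulr_ge0 ?(ltW w0) ?(ltW sA0) ?(ltW se0) ?gt_eqF//.
  rewrite !divfK ?gt_eqF// /N !powR_posE ?(ltW se0)//.
  rewrite -[w * sin eta]mulrC -[w * sin (th eta)]mulrC.
  by rewrite powR_prodD ?(ltW w0) ?(ltW se0) ?gt_eqF// mulrC.
- by rewrite divr_ge0 ?mulr_ge0// ltW.
- by lra.
- have sE : s = sin eta * cos (th eta) - cos eta * sin (th eta) by rewrite /s sinB.
  have sn : s != 0 by rewrite gt_eqF.
  apply/eqP; rewrite eq_complex /=; apply/andP; split; apply/eqP; last by field.
  by apply: (mulIf sn); rewrite mulrDl -!mulrA !(mulrCA s^-1) mulVf// sE; ring.
Qed.

(** * The set of values and the curve, as sets of the plane *)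

Definition sector_image : set R[i] := [set z | exists t eta,
  [/\ 0 <= t, - a <= eta <= a & sector_map t eta = z]].

(** The values on the side [eta = a] of the sector, parametrized by the argument [theta] of u + w;
    the law of sines has eliminated the two moduli. *)
Definition edge theta : R[i] :=
  polar (w `^ (d + g) * (sin theta `^ d * sin a `^ g / sin (a - theta) `^ (d + g)))
        (g * theta + d * a).

Definition edges : set R[i] :=
  [set edge theta | theta in [set theta : R | 0 <= theta < a]] `|`
  conj_set [set edge theta | theta in [set theta : R | 0 <= theta < a]].

(** The unsigned argument lets one function serve both half-planes. At the origin the argument is
    only a default value, so 0 is always treated apart. *)
Definition plane_level (z : R[i]) := level (modulus z) (aarg z).

Lemma sector_map_conj t eta : 0 <= t -> 0 <= eta <= a ->
  sector_map t (- eta) = conjc (sector_map t eta).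
Proof.
params; move=> t0 /andP[e0 ea].
have [|p [theta [wp /andP[T0 Te] zE _ _]]] := @triangle _ w t eta w0 t0; first lra.
have p0 : 0 <= p by lra.
rewrite (@sector_map_polar t eta p theta) //; last lra.
rewrite (@sector_map_polar t (- eta) p (- theta)) //; last 2 first.
- lra.
- by rewrite -!conjc_polar -zE rmorphD/= /conjc/= oppr0.
by rewrite conjc_polar !mulrN opprD.
Qed.

Lemma sector_image_conj z : sector_image z -> sector_image (conjc z).
Proof.
move=> [t [eta [t0 /andP[e1 e2] <-]]]; exists t, (- eta); split => //.
  by rewrite lerN2 e2 lerNl.
have [e0|e0] := leP 0 eta; first by rewrite sector_map_conj// e0.
by rewrite -[in RHS](opprK eta) [in RHS]sector_map_conj ?conjcK// oppr_ge0 (ltW e0) lerNl.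
Qed.

Lemma plane_level_conj z : plane_level (conjc z) = plane_level z.
Proof. by rewrite /plane_level modulus_conj aarg_conj. Qed.

Lemma plane_level_polar m phi : 0 < m -> 0 <= phi <= pi ->
  plane_level (polar m phi) = level m phi.
Proof. by move=> m0 p0; rewrite /plane_level modulus_polar ?(ltW m0)// aarg_polar. Qed.

Lemma polar_ind (P : R[i] -> Prop) : (forall z, P z -> P (conjc z)) ->
  (forall m phi, 0 < m -> 0 <= phi <= pi -> P (polar m phi)) ->
  forall z, z != 0 -> P z.
Proof.
move=> Pc Pp z z0; have h : P (polar (modulus z) (aarg z)).
  by apply: Pp; [rewrite modulus_gt0|exact: aarg_itv].
by have [->|->] := polar_aarg z; [|exact: Pc].
Qed.

Lemma sector_image_half z : sector_image z ->
  exists t eta, [/\ 0 <= t, 0 <= eta <= a &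
    sector_map t eta = z \/ sector_map t eta = conjc z].
Proof.
move=> [t [eta [t0 /andP[e1 e2] zE]]]; have [e0|e0] := leP 0 eta.
  by exists t, eta; split => //; [rewrite e0|left].
have h : 0 <= - eta <= a by rewrite oppr_ge0 (ltW e0) lerNl.
exists t, (- eta); split => //; right.
by rewrite -zE -[in RHS](opprK eta) [in RHS]sector_map_conj// conjcK.
Qed.

(** The factor (u + w)^g has no zero on the sector, so 0 can only be attained at u = 0, and only if
    0^d = 0. *)
Lemma sector_image0 : sector_image 0 <-> d != 0.
Proof.
params; split=> [/sector_image_half[t [eta [t0 eI zE]]]|dn0].
  have {}zE : sector_map t eta = 0 by case: zE => //; rewrite conjc0.
  have [m [phi [m0 _ sE _ mE]]] := level_sector t0 eI.
  by move/eqP: zE; rewrite sE polar_eq0// mE => /andP[].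
exists 0, 0; split => //; first lra.
by rewrite /sector_map powR0// polar0 mul0r.
Qed.

Lemma sector_imageP z : z != 0 -> sector_image z <-> 0 <= plane_level z.
Proof.
params; move=> z0; split=> [/sector_image_half[t [eta [t0 eI zE]]]|].
  have [m [phi [m0 /andP[p0 p1] sE l0 _]]] := level_sector t0 eI.
  have pz : plane_level z = plane_level (polar m phi).
    by rewrite -sE; case: zE => ->; rewrite ?plane_level_conj.
  rewrite pz plane_level_polar//; last by lra.
  rewrite lt_def m0 andbT; apply/eqP => mE; move/eqP: z0; apply.
  have {}sE : sector_map t eta = 0 by rewrite sE mE polar0.
  case: zE => zE; first by rewrite -zE.
  by rewrite -[z]conjcK -zE sE conjc0.
move: z z0; apply: polar_ind => [z h|m phi m0 /andP[p0 p1]].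
  by rewrite plane_level_conj => /h/sector_image_conj.
rewrite plane_level_polar ?p0// => l0.
have [t [eta [t0 /andP[e1 e2] zE]]] := sector_map_surj m0 p0 l0.
by exists t, eta; split => //; rewrite e2 andbT; lra.
Qed.

Lemma edge_modulus_ge0 theta : 0 <= w `^ (d + g) *
  (sin theta `^ d * sin a `^ g / sin (a - theta) `^ (d + g)).
Proof. by rewrite mulr_ge0 ?divr_ge0 ?mulr_ge0 ?powR_ge0. Qed.

Lemma edge_arg_itv theta : 0 <= theta < a -> 0 <= g * theta + d * a <= (d + g) * a.
Proof.
params; move=> /andP[h1 h2]; have := mulr_ge0 d0 (ltW a0).
have : 0 <= g * theta by rewrite mulr_ge0// ltW.
have : g * theta < g * a by rewrite ltr_pM2l.
lra.
Qed.

Lemma edges0 : edges 0 <-> d != 0.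
Proof.
params.
have h (theta : R) : 0 <= theta < a ->
    (edge theta == 0) = (theta == 0) && (d != 0).
  move=> /andP[h1 h2]; rewrite polar_eq0 ?edge_modulus_ge0// !mulf_eq0 invr_eq0 !powR_eq0.
  have s1 : 0 < sin (a - theta) by rewrite sin_gt0_pi//; lra.
  rewrite (gt_eqF s1) (gt_eqF w0) (gt_eqF sa0) /= !orbF; congr (_ && _).
  have [->|t0] := eqVneq theta 0; first by rewrite sin0 eqxx.
  by rewrite gt_eqF// sin_gt0_pi// lt_def t0 h1/=; lra.
split=> [[[theta tI tE]|[theta tI tE]]|dn0].
- by move/eqP: tE; rewrite h// => /andP[].
- by move/eqP: tE; rewrite conjc0 h// => /andP[].
- left; exists 0; first by rewrite /= lexx.
  by apply/eqP; rewrite h ?lexx// eqxx.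
Qed.

Lemma edges_conj z : edges z -> edges (conjc z).
Proof. by case=> h; [right; rewrite /conj_set/= conjcK|left]. Qed.

Lemma plane_level_edge theta : 0 <= theta < a -> edge theta != 0 -> plane_level (edge theta) = 0.
Proof.
params; move=> tI; have /andP[h1 h2] := tI; have /andP[p1 p2] := edge_arg_itv tI.
rewrite polar_eq0 ?edge_modulus_ge0// => m0.
have s1 : 0 < sin (a - theta) by rewrite sin_gt0_pi//; lra.
rewrite plane_level_polar; last 2 first.
- by rewrite lt_def m0 edge_modulus_ge0.
- lra.
have tE : theta_of (g * theta + d * a) = theta.
  by rewrite /theta_of addrK [g * theta]mulrC mulfK ?(gt_eqF g0)// clamp_id ?h1 ?ltW.
by rewrite /level tE !mulrA divfK ?subrr// gt_eqF// powR_gt0.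
Qed.

Lemma edgesP z : z != 0 -> edges z <-> plane_level z = 0.
Proof.
params; move=> z0; split.
  case=> [[theta tI tE]|[theta tI tE]].
    by rewrite -tE plane_level_edge// tE.
  rewrite -plane_level_conj -tE plane_level_edge// tE.
  by apply: contra z0 => /eqP h; rewrite -[z]conjcK h conjc0.
move: z z0; apply: polar_ind => [z h|m phi m0 /andP[p0 p1]].
  by rewrite plane_level_conj => /h/edges_conj.
rewrite plane_level_polar ?p0// => lE; left.
have pb : phi < (d + g) * a.
  by rewrite ltNge; apply/negP => /(@level_max m); lra.
(* The curve starts at argument d a. Below it [d] is nonzero, the truncated angle is 0, and the
   level is a positive multiple of [m]. *)
have pda : d * a <= phi.
  rewrite leNgt; apply/negP => h.
  have dn0 : d != 0 by apply/eqP => dE; move: h; rewrite dE mul0r; lra.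
  have th0 : theta_of phi = 0.
    rewrite /theta_of /clamp min_r ?max_l//.
      by rewrite pmulr_lle0 ?invr_gt0//; lra.
    by rewrite (@le_trans _ _ 0) ?(ltW a0)// pmulr_lle0 ?invr_gt0//; lra.
  move/eqP: lE; rewrite /level th0 sin0 powR0// mul0r mulr0 !subr0.
  by rewrite gt_eqF// mulr_gt0// powR_gt0.
have u0 : 0 <= (phi - d * a) / g by rewrite divr_ge0 ?subr_ge0// ltW.
have ua : (phi - d * a) / g < a by rewrite ltr_pdivrMr//; lra.
exists ((phi - d * a) / g); first by rewrite /= u0 ua.
rewrite /edge [g * _]mulrC divfK ?(gt_eqF g0)// subrK; congr polar.
move: lE; rewrite /level /theta_of clamp_id; last lra.
have s1 : 0 < sin (a - (phi - d * a) / g) by rewrite sin_gt0_pi//; lra.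
move/eqP; rewrite subr_eq0 => /eqP mE.
by rewrite mulrA -mE mulfK// gt_eqF// powR_gt0.
Qed.

(** The origin is decided by hand: it is avoided when [d = 0], and otherwise it is a value lying on
    the curve. *)
Definition outside : set R[i] := [set z | if z == 0 then d == 0 else plane_level z < 0].

Definition inside : set R[i] := [set z | z != 0 /\ 0 < plane_level z].

Lemma outsideE : outside = ~` sector_image.
Proof.
apply/seteqP; split => z; rewrite /outside/=.
  have [->|z0] := eqVneq z 0; first by move=> dE /sector_image0; rewrite dE.
  by move=> l0 /(sector_imageP z0); rewrite leNgt l0.
have [->|z0] := eqVneq z 0.
  by move=> nz; apply/eqP; apply: contra_notP nz => /eqP /sector_image0.
by move=> nz; rewrite ltNge; apply/negP => /(sector_imageP z0).
Qed.

Lemma edges_split : ~` edges = outside `|` inside.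
Proof.
apply/seteqP; split => z; rewrite /outside /inside/=; have [->|z0] := eqVneq z 0.
- by move=> nz; left; apply/eqP; apply: contra_notP nz => /eqP /edges0.
- move=> nz; have : plane_level z != 0 by apply: contra_notN nz => /eqP /(edgesP z0).
  by rewrite neq_lt => /orP[|]; [left|right].
- by move=> [/eqP dE|[]//] /edges0; rewrite dE eqxx.
- by move=> [l0|[_ l0]] /(edgesP z0) lE; move: l0; rewrite lE ltxx.
Qed.

Lemma outside_inside : outside `&` inside = set0.
Proof.
apply/seteqP; split => // z; rewrite /outside /inside/= => -[+ [z0 l0]].
by rewrite (negPf z0) => /lt_trans /(_ l0); rewrite ltxx.
Qed.

(** * Openness of both sides of the curve *)

Lemma continuous_theta_of : continuous theta_of.
Proof.
move=> x; apply: (@continuous_comp _ _ _ (fun x => (x - d * a) / g) (clamp 0 a)).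
  by apply: cvgMr_tmp; apply: cvgB; [exact: cvg_id|exact: cvg_cst].
exact: continuous_clamp.
Qed.

Lemma sin_theta_ge0 phi : 0 <= sin (theta_of phi) /\ 0 <= sin (a - theta_of phi).
Proof.
params; have /andP[h1 h2] := theta_of_itv phi.
by split; apply: sin_ge0_pi; lra.
Qed.

Lemma continuous_plane_level z : z != 0 -> {for z, continuous (plane_level : R[i] -> R)}.
Proof.
params; move=> z0.
pose B phi := powR_pos (d + g) (sin (a - theta_of phi)).
pose C phi := w `^ (d + g) * (powR_pos d (sin (theta_of phi)) * sin a `^ g).
have cB : continuous B.
  move=> x; apply: (@continuous_comp _ _ _ (fun x => sin (a - theta_of x)) (powR_pos (d + g))).
    apply: (@continuous_comp _ _ _ (fun x => a - theta_of x) sin).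
      by apply: cvgB; [exact: cvg_cst|exact: continuous_theta_of].
    exact: continuous_sin.
  by apply: continuous_powR_pos; exact: ltW.
have cC : continuous C.
  move=> x; apply: cvgMl_tmp; apply: cvgMr_tmp.
  apply: (@continuous_comp _ _ _ (sin \o theta_of) (powR_pos d)); last exact: continuous_powR_pos.
  by apply: continuous_comp; [exact: continuous_theta_of|exact: continuous_sin].
rewrite (_ : plane_level = (@modulus R \* (B \o @aarg R)) - (C \o @aarg R)); last first.
  apply/funext => v; have [h1 h2] := sin_theta_ge0 (aarg v).
  by rewrite /plane_level /level -(powR_posE d h1) -(powR_posE (d + g) h2).
apply: continuousB; last first.
  by apply: continuous_comp; [exact: continuous_aarg|exact: cC].
apply: continuousM; first exact: continuous_modulus.
by apply: continuous_comp; [exact: continuous_aarg|exact: cB].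
Qed.

Lemma open_neq0 : open [set z : R[i] | z != 0].
Proof.
have -> : [set z : R[i] | z != 0] = @modulus R @^-1` [set x | 0 < x].
  by apply/seteqP; split => z /=; rewrite modulus_gt0.
apply: open_comp; first by move=> z _; exact: continuous_modulus.
exact: open_gt.
Qed.

Lemma inside_open : open inside.
Proof.
rewrite openE => z [z0 l0].
have h1 : \forall v \near z, v != 0 by apply: open_neq0.
have h2 : nbhs z (plane_level @^-1` [set x | 0 < x]).
  by apply: continuous_plane_level => //; exact: lt_nbhsr.
by apply: filterS2 h1 h2.
Qed.

Lemma outside_open : open outside.
Proof.
params; rewrite openE => z; rewrite /outside/=.
have [->{z} /eqP dE|z0 l0] := eqVneq z 0; last first.
  have h1 : \forall v \near z, v != 0 by apply: open_neq0.
  have h2 : nbhs z (plane_level @^-1` [set x | x < 0]).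
    by apply: continuous_plane_level => //; exact: lt_nbhsl.
  by apply: filterS2 h1 h2 => v /= v0; rewrite (negPf v0).
(* The origin is outside only if [d = 0]. Then the subtracted term of [level] is the constant [N],
   and sin (a - theta) <= 1 puts the whole disc of radius [N] outside. *)
pose N := w `^ (d + g) * sin a `^ g.
have N0 : 0 < N by rewrite mulr_gt0// powR_gt0.
have h : nbhs (0 : R[i]) (@modulus R @^-1` [set x | x < N]).
  apply: continuous_modulus; apply: lt_nbhsl.
  by rewrite /modulus normr0.
apply: filterS h => v /= vN; case: eqP => [_|_]; first exact/eqP.
rewrite /plane_level /level.
have -> : sin (theta_of (aarg v)) `^ d = 1 by rewrite dE powRr0.
rewrite mul1r subr_lt0 -/N (le_lt_trans _ vN)//.
rewrite ler_piMr ?modulus_ge0//.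
have [_ h2] := sin_theta_ge0 (aarg v).
have -> : 1 = 1 `^ (d + g) :> R by rewrite powR1.
by rewrite ge0_ler_powR ?nnegrE ?(ltW b0) ?sin_le1.
Qed.

(** * Connectedness of the outside, and the curve as a part of its closure *)

Lemma outside_conj z : outside z -> outside (conjc z).
Proof. by rewrite /outside/= conjc_eq0 plane_level_conj. Qed.

Lemma outside_polar m phi : 0 < m -> 0 <= phi <= pi ->
  outside (polar m phi) <-> level m phi < 0.
Proof.
by move=> m0 p0; rewrite /outside/= polar_eq0 ?(ltW m0)// (gt_eqF m0) plane_level_polar.
Qed.

Lemma outside_pi m : 0 < m -> outside (polar m pi).
Proof.
params; move=> m0; apply/outside_polar => //; first lra.
by apply: level_max; lra.
Qed.

(** A negative real part means an unsigned argument above pi / 2, hence above [(d + g) * a], where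
    [level_max] applies. *)
Lemma Cminus_outside : @Cminus R `<=` outside.
Proof.
params; move=> z zn; have z0 : z != 0.
  by apply: contraTneq zn => ->; rewrite /Cminus/= ltxx.
rewrite /outside/= (negPf z0); apply: level_max.
apply: le_trans ba _; rewrite leNgt; apply/negP => h.
have /andP[h1 h2] := aarg_itv z0.
have : cos (pi / 2) < cos (aarg z) by rewrite ltr_cos ?in_itv/= ?h1//; lra.
rewrite cos_pihalf acosK; last by rewrite in_itv/=; exact: Arg_cos_itv.
by rewrite pmulr_lgt0 ?invr_gt0 ?modulus_gt0// ltNge (ltW zn).
Qed.

Lemma negative_ray_connected : connected (polar^~ pi @` [set x : R | 0 < x] : set R[i]).
Proof.
apply: connected_continuous_connected.
  by apply/connected_intervalP => x y /= x0 _ z /andP[xz _]; exact: lt_le_trans xz.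
by apply: continuous_subspaceT; exact: continuous_polar_modulus.
Qed.

(** The negative real axis serves as a hub: by [level_homo], each nonzero point outside is joined to
    it by a circular arc that stays outside. *)
Lemma outside_connected : connected outside.
Proof.
params; pose z1 : R[i] := polar 1 pi.
have raysub : polar^~ pi @` [set x : R | 0 < x] `<=` outside.
  by move=> _ [x x0 <-]; exact: outside_pi.
have ray1 : (polar^~ pi @` [set x : R | 0 < x]) z1 by exists 1 => //=.
suff : connected_component outside z1 = outside.
  by move=> <-; exact: component_connected.
apply/seteqP; split; first exact: connected_component_sub.
suff h m phi : 0 < m -> 0 <= phi <= pi -> level m phi < 0 ->
    connected_component outside z1 (polar m phi) /\
    connected_component outside z1 (polar m (- phi)).
  move=> z; have [->|z0] := eqVneq z 0 => zS.
    (* The origin is reached along the negative ray itself, closed up at 0. *)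
    have dE : d == 0 by move: zS; rewrite /outside/= eqxx.
    exists (polar^~ pi @` [set x : R | 0 <= x]); last first.
      by exists 0 => //=; rewrite polar0.
    split; first by exists 1 => //=.
      move=> _ [x /= + <-]; rewrite le_eqVlt => /predU1P[<-|x0]; last exact: outside_pi.
      by rewrite polar0 /outside/= eqxx.
    apply: connected_continuous_connected.
      by apply/connected_intervalP => x y /= x0 _ u /andP[xu _]; exact: le_trans xu.
    by apply: continuous_subspaceT; exact: continuous_polar_modulus.
  have m0 : 0 < modulus z by rewrite modulus_gt0.
  have pI := aarg_itv z0.
  have lz : level (modulus z) (aarg z) < 0.
    by move: zS; rewrite /outside/= (negPf z0).
  by have [h1 h2] := h _ _ m0 pI lz; have [->|->] := polar_aarg z; rewrite ?conjc_polar.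
move=> m0 /andP[p0 p1] l0.
(* Stated for a general path, to serve both for the arc in the upper half-plane and for its mirror
   image; both end at [polar m pi]. *)
have arc (f : R -> R[i]) : continuous f -> f pi = polar m pi ->
    (forall t, phi <= t <= pi -> outside (f t)) ->
    connected_component outside z1 (f phi).
  move=> cf fpi fS.
  exists (f @` `[phi, pi] `|` polar^~ pi @` [set x : R | 0 < x]); last first.
    by left; exists phi => //=; rewrite in_itv/= lexx.
  split; first by right.
    move=> v [[t /=]|/raysub//]; rewrite in_itv/= => tI <-; exact: fS.
  apply: connectedU.
  - exists (polar m pi); split; last by exists m.
    by exists pi => //=; rewrite in_itv/= lexx andbT.
  - apply: connected_continuous_connected; first exact: segment_connected.
    exact: continuous_subspaceT.
  - exact: negative_ray_connected.
have pS t : phi <= t <= pi -> outside (polar m t).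
  move=> /andP[t1 t2]; apply/outside_polar => //; first lra.
  by apply: le_lt_trans l0; apply: level_homo => //; exact: ltW.
split; first exact: (arc (polar m) (@continuous_polar _ m)).
apply: (arc (fun t => polar m (- t))).
- move=> t; apply: (@continuous_comp _ _ _ (@GRing.opp R) (polar m)).
    exact: opp_continuous.
  exact: continuous_polar.
- by rewrite /polar cosN sinN sinpi oppr0.
- by move=> t /pS /outside_conj; rewrite conjc_polar.
Qed.

(** On the ray of a nonzero curve point [level] is strictly increasing in the modulus, so shrinking
    that point slightly moves it outside. The origin is approached along the negative axis. *)
Lemma edges_closure : edges `<=` closure outside.
Proof.
params; move=> z; have [->|z0] := eqVneq z 0.
  move=> _ B; rewrite -(polar0 pi) => /(@continuous_polar_modulus R pi 0).
  move=> /nbhs_ballP[e /= e0 eB]; exists (polar (e / 2) pi); split.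
    by apply: outside_pi; rewrite divr_gt0.
  by apply: eB; rewrite /ball/= sub0r normrN gtr0_norm ?divr_gt0//; lra.
move=> /(edgesP z0) lz B.
rewrite {1}[z]polarE => /(@continuous_polar_modulus R (Arg z) (modulus z)).
have m0 : 0 < modulus z by rewrite modulus_gt0.
move=> /nbhs_ballP[e /= e0 eB].
(* The first bound keeps the new modulus positive, the second keeps the new point inside the
   ball. *)
pose c := Num.max (modulus z / 2) (modulus z - e / 2).
have cm : c < modulus z by rewrite /c gt_max; apply/andP; split; lra.
have c0 : 0 < c by rewrite /c lt_max divr_gt0.
have ce : modulus z - e / 2 <= c by rewrite /c le_max lexx orbT.
exists (polar c (Arg z)); split; last first.
  by apply: eB; rewrite /ball/= gtr0_norm ?subr_gt0//; lra.
have aE : aarg (polar c (Arg z)) = aarg z.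
  by rewrite [z in RHS]polarE !aarg_polar_cos.
rewrite /outside/= polar_eq0 ?(ltW c0)// (gt_eqF c0).
rewrite /plane_level modulus_polar ?(ltW c0)// aE.
have /andP[h1 h2] := theta_of_itv (aarg z).
have tha : theta_of (aarg z) < a.
  rewrite lt_neqAle h2 andbT; apply/eqP => /(@level_theta_max (modulus z)).
  by rewrite -/(plane_level z) lz ltxx.
rewrite -lz ltrD2r ltr_pM2r// powR_gt0// sin_gt0_pi//; lra.
Qed.



End Sector.

(** * Return to the original parameters through u = s^alpha *)

Theorem theorem1 (R : realType) (alpha beta gamma omega : R)
  (homega : omega < 0)
  (halpha : 0 < alpha <= 1)
  (halphagamma : 0 < alpha * gamma)
  (hbeta : alpha * gamma <= beta <= 1) :
  let S := stability_region alpha beta gamma omega in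
  let curve := Psi alpha beta gamma omega
               `|` conj_set (Psi alpha beta gamma omega) in
  [/\ @Cminus R `<=` S,
      forall z, Cminus z -> connected_component (~` curve) z = S
    & boundary S = curve].
Proof.
have /andP[al0 al1] := halpha; have /andP[ab b1] := hbeta.
have pi0 := pi_gt0 R.
have g0 : 0 < gamma by rewrite -(pmulr_rgt0 _ al0).
have w0 : 0 < `|omega| by rewrite normr_gt0 lt_eqF.
pose a := alpha * pi / 2; pose d := beta / alpha - gamma.
have a0 : 0 < a by rewrite /a divr_gt0// mulr_gt0.
have a2 : a <= pi / 2 by rewrite /a ler_pM2r// ler_piMl ?(ltW pi0).
have d0 : 0 <= d by rewrite subr_ge0 ler_pdivlMr// mulrC.
have dal : alpha * d = beta - alpha * gamma by rewrite /d; field; rewrite gt_eqF.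
have dg : d + gamma = beta / alpha by rewrite subrK.
have ba : (d + gamma) * a <= pi / 2.
  have -> : (d + gamma) * a = beta * (pi / 2) by rewrite dg /a; field; rewrite gt_eqF.
  by rewrite ler_piMl// divr_ge0 ?(ltW pi0).
have edgeE theta : Lambda alpha beta gamma omega theta =
    edge a d gamma `|omega| theta.
  rewrite /Lambda /edge dg -/a -/d.
  have -> : (beta - alpha * gamma) * (pi / 2) = d * a by rewrite -dal /a; ring.
  rewrite /Cexp /= expR0 mul1r; apply/eqP; rewrite eq_complex /=.
  by rewrite !mul0r subr0 addr0 !eqxx.
(* With u = s^alpha, the identity alpha d = beta - alpha gamma turns s^(beta - alpha gamma) into
   u^d, and - omega is the modulus of [omega]. *)
have mapE r psi : 0 <= r -> - (pi / 2) <= psi <= pi / 2 ->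
    cpow (polar r psi) (beta - alpha * gamma) *
      cpow (cpow (polar r psi) alpha - omega%:C) gamma =
    sector_map d gamma `|omega| (r `^ alpha) (alpha * psi).
  move=> r0 psiI; have psiI' : - pi < psi <= pi by lra.
  rewrite !(cpow_polar _ r0 psiI').
  rewrite /sector_map -powRrM dal ltr0_norm// rmorphN/=.
  by rewrite mulrA [d * alpha]mulrC dal.
have SE : stability_region alpha beta gamma omega = outside a d gamma `|omega|.
  rewrite outsideE//; apply/seteqP; split => lam /= h.
    move=> [t [eta [t0 /andP[e1 e2] tE]]].
    (* A preimage of [polar t eta] under s -> s^alpha has angle [eta / alpha]; as a / alpha = pi /
       2, it lies in the closed right half-plane. *)
    have psiI : - (pi / 2) <= eta / alpha <= pi / 2.
      by rewrite ler_pdivlMr// ler_pdivrMr//; move: e1 e2; rewrite /a; lra.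
    have rp : 0 <= complex.Re (polar (t `^ alpha^-1) (eta / alpha)).
      by rewrite /= mulr_ge0 ?powR_ge0// cos_ge0_pihalf.
    move/eqP: (h _ rp); apply.
    rewrite mapE ?powR_ge0// -powRrM mulVf ?(gt_eqF al0)// powRr1//.
    by rewrite [alpha * _]mulrC divfK ?(gt_eqF al0).
  move=> s s0; apply/eqP => sE; apply: h.
  have [r [psi [r0 psiI rE]]] : exists r psi, [/\ 0 <= r,
      - (pi / 2) <= psi <= pi / 2 & s = polar r psi].
    have [->|sn0] := eqVneq s 0; first by exists 0, 0; rewrite polar0; split => //; lra.
    exists (modulus s), (Arg s); split; [exact: modulus_ge0| |exact: polarE].
    exact: Re_ge0_Arg.
  exists (r `^ alpha), (alpha * psi); split; first exact: powR_ge0.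
    move/andP: psiI => [p1 p2].
    by rewrite /a -mulrA -mulrN !ler_pM2l// p1 p2.
  by rewrite -mapE// -rE.
have CE : Psi alpha beta gamma omega `|` conj_set (Psi alpha beta gamma omega) =
    edges a d gamma `|omega|.
  rewrite /edges /Psi.
  by under eq_imagel do rewrite edgeE.
move=> S curve; rewrite /S /curve SE CE.
have CS : @Cminus R `<=` outside a d gamma `|omega|.
  exact: Cminus_outside.
have [h1 h2] := component_boundary_of_split (outside_open a0 a2 d0 g0 w0 ba)
  (inside_open a0 a2 d0 g0 w0 ba) (outside_inside _ _ _ _)
  (edges_split a0 a2 d0 g0 w0 ba) (outside_connected a0 a2 d0 g0 w0 ba)
  (edges_closure a0 a2 d0 g0 w0 ba).
by split => // z /CS /h1.
Qed.
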